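(* Let $m\ge 1$ be an integer. If $m=2^n$ for some integer $n\ge 0$, then every maximal set of distinct Hadamard vectors in $\mathbb{R}^m$ can be partitioned into $2^{2^n-n-1}$ Hadamard matrices. Moreover, if $m$ is not of the form $2^n$ with $n\ge 0$ an integer, then no maximal set of distinct Hadamard vectors in $\mathbb{R}^m$ can be partitioned into Hadamard matrices.
   Context: A Hadamard vector in $\mathbb{R}^m$ is a vector all of whose $m$ coordinates belong to $\{+1,-1\}$. There are $2^m$ Hadamard vectors in $\mathbb{R}^m$, occurring in pairs $\{x,-x\}$. Hadamard vectors are counted as distinct only up to sign: a maximal set of distinct Hadamard vectors in $\mathbb{R}^m$ is a set containing exactly one of $x,-x$ for each Hadamard vector $x\in\mathbb{R}^m$ (so it has $2^{m-1}$ elements). A Hadamard matrix (of order $m$) is an $m\times m$ matrix whose rows are Hadamard vectors in $\mathbb{R}^m$ that are pairwise orthogonal for the standard inner product. A set $S$ of Hadamard vectors in $\mathbb{R}^m$ can be partitioned into ($k$) Hadamard matrices if $S$ is the disjoint union of ($k$) subsets, each of which consists of exactly $m$ vectors that are the rows of an $m\times m$ Hadamard matrix. *)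

(* Defs.v *)
From mathcomp Require Import all_boot all_order all_algebra.
From mathcomp Require Import classical_sets functions cardinality reals.

Set Implicit Arguments.
Unset Strict Implicit.
Unset Printing Implicit Defensive.

Import Order.TTheory GRing.Theory Num.Theory.
Local Open Scope classical_set_scope.
Local Open Scope ring_scope.

Definition hadamard_vector (R : realType) (m : nat) (x : 'rV[R]_m) : Prop :=
  forall i : 'I_m, x 0 i = 1 \/ x 0 i = -1.

Definition inner (R : realType) (m : nat) (x y : 'rV[R]_m) : R :=
  \sum_(i < m) x 0 i * y 0 i.

Definition hadamard_matrix (R : realType) (m : nat) (H : 'M[R]_m) : Prop :=
  (forall i : 'I_m, hadamard_vector (row i H)) /\
  (forall i j : 'I_m, i != j -> inner (row i H) (row j H) = 0).

Definition maximal_distinct (R : realType) (m : nat) (S : set 'rV[R]_m) : Prop :=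
  (forall x, S x -> hadamard_vector x) /\
  (forall x, hadamard_vector x -> (S x /\ ~ S (- x)) \/ (~ S x /\ S (- x))).

Definition forms_hadamard_matrix (R : realType) (m : nat)
    (B : set 'rV[R]_m) : Prop :=
  (B #= `I_m)%card /\
  exists H : 'M[R]_m, hadamard_matrix H /\ B = [set row i H | i in [set: 'I_m]].

Definition partitioned_into_hadamard (R : realType) (m k : nat)
    (S : set 'rV[R]_m) : Prop :=
  exists B : 'I_k -> set 'rV[R]_m,
    [/\ S = \bigcup_i B i,
        trivIset [set: 'I_k] B
      & forall i, forms_hadamard_matrix (B i)].

(* Main.v *)
Require Import Defs.
From mathcomp Require Import all_boot all_order all_algebra.
From mathcomp Require Import classical_sets functions cardinality reals.
From mathcomp Require Import boolp.

(** A Hadamard vector of order [m] is [signs R x], with coordinates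
    [(-1) ^+ x i], for a unique Boolean function [x] on the [m] coordinates, and
    negating the vector amounts to adding the constant function [true].  The
    problem thus lives in the vector space of Boolean functions over the field
    with two elements, where [bool] carries exclusive or as its addition.

    When [m = 2 ^ n], the coordinates are identified with the points of the cube
    of dimension [n].  The affine functions [t |-> a . t + b] form a subgroup
    with [2 ^ n.+1] elements (the first-order Reed-Muller code), and the
    partition of a maximal set [S] is its trace on the cosets of that subgroup
    ([partition_pow2]).  There are [2 ^ 2 ^ n / 2 ^ n.+1] cosets
    ([card_cosets]).  Fix one, [x + affine functions].  The functions
    [x + (a . t)] and [x + (a . t + 1)] give opposite vectors, so for each of
    the [2 ^ n] slopes [a] exactly one of them is in [S].  Two chosen vectors
    with distinct slopes are orthogonal, because [x] cancels from their inner
    product, which is left as plus or minus the sum over the cube of the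
    nontrivial character of slope [a - a'] ([sum_walsh], [inner_translates]).
    Hence the chosen vectors are the rows of a Hadamard matrix
    ([coset_forms_hadamard]).

    The converse is a count: a maximal set has half of the [2 ^ m] Hadamard
    vectors ([card_maximal]), whereas [k] disjoint Hadamard matrices have [k * m]
    rows ([card_partitioned]), so [m] divides a power of two. *)

Section Hadamard.

Import GRing.Theory Num.Theory.
Local Open Scope ring_scope.
Set Implicit Arguments.
Unset Strict Implicit.
Unset Printing Implicit Defensive.

(** * Hadamard vectors as Boolean functions *)

Definition signs (R : realType) (m : nat) (x : {ffun 'I_m -> bool}) : 'rV[R]_m :=
  \row_i (-1) ^+ x i.

Definition all_true (m : nat) : {ffun 'I_m -> bool} := [ffun=> true].

Lemma one_neqN1 (R : realType) : (1 : R) != -1.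
Proof. by rewrite -subr_eq0 opprK -mulr2n pnatr_eq0. Qed.

Lemma signs_inj (R : realType) m : injective (@signs R m).
Proof.
move=> x y /rowP exy; apply/ffunP => i.
move: (exy i); rewrite !mxE => /eqP.
have one_neqN1 := negbTE (one_neqN1 R).
by case: (x i) (y i) => [] [] //; rewrite ?expr0 ?expr1 ?one_neqN1 // eq_sym one_neqN1.
Qed.

Lemma signsN (R : realType) m x : signs R (x + all_true m) = - signs R x.
Proof.
apply/rowP => i; rewrite !mxE !ffunE.
by rewrite -[x i + true]/(x i (+) true) signr_addb expr1 mulrN1.
Qed.

Lemma signs_hadamard (R : realType) m x : hadamard_vector (@signs R m x).
Proof. by move=> i; rewrite mxE; case: (x i); [right | left]. Qed.

Lemma hadamard_signs (R : realType) m (v : 'rV[R]_m) :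
  hadamard_vector v -> exists x, v = signs R x.
Proof.
move=> hv; exists [ffun i => v 0 i == -1]; apply/rowP => i; rewrite !mxE ffunE.
have [->|->] := hv i; last by rewrite eqxx.
by rewrite (negbTE (one_neqN1 R)).
Qed.

Lemma inner_signs_self (R : realType) m x : inner (@signs R m x) (signs R x) = m%:R.
Proof.
rewrite /inner (eq_bigr (fun=> 1)) => [|i _].
  by rewrite sumr_const card_ord.
by rewrite mxE -signr_addb addbb.
Qed.

(** Equal rows would be orthogonal, but a Hadamard vector has squared norm
    [m], which is nonzero as soon as there is a row. *)
Lemma hadamard_row_inj (R : realType) m (H : 'M[R]_m) :
  hadamard_matrix H -> injective (fun i => row i H).
Proof.
move=> [hv ho] i j /= eij; apply/eqP/negPn/negP => nij.
have := ho _ _ nij; rewrite -eij.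
have [x ->] := hadamard_signs (hv i).
by rewrite inner_signs_self => /eqP; rewrite pnatr_eq0 => /eqP m0; case: (i); rewrite m0.
Qed.

Lemma forms_hadamard_rows (R : realType) m (H : 'M[R]_m) :
  hadamard_matrix H -> forms_hadamard_matrix [set row i H | i in [set: 'I_m]]%classic.
Proof.
move=> hH; split; last by exists H.
apply: card_eq_trans (inj_card_eq _) _; first by move=> i j _ _; apply: hadamard_row_inj.
by rewrite card_eq_sym; apply: card_II.
Qed.

Lemma maximal_signs (R : realType) m (S : set 'rV[R]_m) x :
  maximal_distinct S -> S (signs R (x + all_true m)) <-> ~ S (signs R x).
Proof. by move=> [_ /(_ _ (@signs_hadamard R m x))]; rewrite signsN; tauto. Qed.

(** * Affine functions on the cube *)

Definition cube (n : nat) := {ffun 'I_n -> bool}.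

Lemma card_cube n : #|{: cube n}| = (2 ^ n)%N.
Proof. by rewrite card_ffun card_bool card_ord. Qed.

(** A labelling of the vector coordinates by the points of the cube. Only its
    bijectivity matters. *)
Definition point n (i : 'I_(2 ^ n)) : cube n :=
  enum_val (cast_ord (esym (card_cube n)) i).

Lemma point_bij n : bijective (@point n).
Proof.
exists (fun t => cast_ord (card_cube n) (enum_rank t)) => t.
  by rewrite /point enum_valK cast_ordKV.
by rewrite /point cast_ordK enum_rankK.
Qed.

Definition dot n (a t : cube n) : bool := \sum_j a j * t j.

Lemma dotBl n (a b t : cube n) : dot (a - b) t = dot a t - dot b t.
Proof. by rewrite /dot -sumrB; apply: eq_bigr => j _; rewrite !ffunE mulrBl. Qed.

Definition affine n (p : cube n * bool) : {ffun 'I_(2 ^ n) -> bool} :=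
  [ffun i => dot p.1 (point i) + p.2].

Lemma affineB n (p q : cube n * bool) : affine (p - q) = affine p - affine q.
Proof.
by apply/ffunP => i; rewrite !ffunE /= dotBl opprD addrACA.
Qed.

Lemma affine_true n : affine (0, true) = all_true (2 ^ n).
Proof.
by apply/ffunP => i; rewrite !ffunE /dot big1 ?add0r // => j _; rewrite ffunE mul0r.
Qed.

(** Orthogonality of the characters of the cube: the sum factors over the
    coordinates, and each coordinate [j] with [a j] contributes the factor
    [1 + -1]. *)
Lemma sum_walsh (R : realType) n (a : cube n) :
  a != 0 -> \sum_(t : cube n) (-1) ^+ dot a t = 0 :> R.
Proof.
move=> a0.
have [j aj] : exists j, a j.
  apply/existsP; apply: contraNT a0; rewrite negb_exists => /forallP a0.
  by apply/eqP/ffunP => j; rewrite ffunE; apply: negbTE.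
transitivity (\sum_(t : cube n) \prod_j (-1) ^+ (a j && t j : bool) : R).
  apply: eq_bigr => t _.
  exact: (big_morph (fun b : bool => (-1) ^+ b) (@signr_addb R) (erefl _)).
rewrite -(bigA_distr_bigA (fun j (b : bool) => (-1) ^+ (a j && b : bool))).
by rewrite (bigD1 j) //= big_bool aj /= expr1 expr0 addNr mul0r.
Qed.

Lemma inner_translates (R : realType) n x (p q : cube n * bool) :
  p.1 != q.1 -> inner (signs R (x + affine p)) (signs R (x + affine q)) = 0.
Proof.
move=> npq.
transitivity (\sum_(i < 2 ^ n)
    (-1) ^+ dot (p.1 - q.1) (point i) * (-1) ^+ (p.2 (+) q.2) : R).
  apply: eq_bigr => i _; rewrite !mxE -!signr_addb; congr (_ ^+ nat_of_bool _).
  (* In [bool], exclusive or is subtraction as well as addition. *)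
  transitivity ((x + affine p) i - (x + affine q) i); first by [].
  by rewrite !ffunE opprD addrACA subrr add0r opprD addrACA dotBl.
rewrite -mulr_suml.
rewrite -(reindex (@point n) (P := xpredT)
  (F := fun t : cube n => (-1) ^+ dot (p.1 - q.1) t)).
  by rewrite sum_walsh ?mul0r // subr_eq0.
exact: onW_bij (point_bij n).
Qed.

(** The constant term of an affine function is its value at the origin, and its
    slope is then read off the points of the canonical basis. *)
Lemma affine_eq0 n (p : cube n * bool) : affine p = 0 -> p = 0.
Proof.
case: p => a b p0.
have eval t : dot a t + b = 0.
  have [g _ gK] := point_bij n.
  by move/ffunP/(_ (g t)): p0; rewrite !ffunE gK.
have b0 : b = 0.
  by rewrite -[RHS](eval 0) /dot big1 ?add0r // => j _; rewrite ffunE mulr0.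
congr (_, _) => //; apply/ffunP => k; rewrite ffunE -(eval [ffun j => j == k]).
rewrite b0 addr0 /dot (bigD1 k) //= big1 ?addr0 => [|j /negbTE njk].
  by rewrite ffunE eqxx mulr1.
by rewrite ffunE njk mulr0.
Qed.

Lemma affine_inj n : injective (@affine n).
Proof.
move=> p q epq; apply/eqP; rewrite -subr_eq0; apply/eqP/affine_eq0.
by rewrite affineB epq subrr.
Qed.

(** * Cosets of the affine functions *)

Definition coset n (x y : {ffun 'I_(2 ^ n) -> bool}) := y - x \in codom (@affine n).

Lemma cosetP n x y : reflect (exists p, y = x + affine p) (@coset n x y).
Proof.
apply: (iffP codomP) => -[p].
  by move/eqP; rewrite subr_eq addrC => /eqP ->; exists p.
by move->; exists p; rewrite addrC addKr.
Qed.

Lemma coset_equiv n : {in [set: {ffun 'I_(2 ^ n) -> bool}]%SET & &,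
  equivalence_rel (@coset n)}.
Proof.
move=> x y z _ _ _; split.
  by apply/cosetP; exists 0; rewrite -(subrr 0) affineB subrr addr0.
move/cosetP => [p ->]; apply/cosetP/cosetP => -[q ->].
  by exists (q - p); rewrite affineB [affine q - _]addrC addrA addrK.
by exists (p + q); rewrite -addrA -{1}[p](addrK q) affineB subrK.
Qed.

Definition cosets n :=
  equivalence_partition (@coset n) [set: {ffun 'I_(2 ^ n) -> bool}]%SET.

Lemma cosets_partition n : finset.partition (cosets n) [set: _]%SET.
Proof. exact: equivalence_partitionP (@coset_equiv n). Qed.

Lemma in_cosets n (C : {set {ffun 'I_(2 ^ n) -> bool}}) :
  C \in cosets n -> exists x, C = [set x + affine p | p : cube n * bool]%SET.
Proof.
case/imsetP => x _ ->; exists x; apply/setP => y; rewrite !inE /=.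
by apply/cosetP/imsetP => [[p ->]|[p _ ->]]; exists p.
Qed.

Lemma card_cosets n : #|cosets n| = (2 ^ (2 ^ n - n - 1))%N.
Proof.
have uniform : {in cosets n, forall C : {set _}, #|C| = (2 ^ n.+1)%N}.
  move=> C /in_cosets [x ->]; rewrite card_imset => [|p q /addrI/affine_inj //].
  by rewrite card_prod card_cube card_bool expnSr.
have := card_uniform_partition uniform (cosets_partition n).
rewrite cardsT card_ffun card_bool card_ord => h.
apply/eqP; rewrite -(eqn_pmul2r (m := 2 ^ n.+1)) ?expn_gt0 // -h -expnD.
by rewrite -subnDA addn1 subnK // ltn_expl.
Qed.

(** The trace of [S] on a coset picks, for each slope, one of the two constant
    terms, and the rows so obtained have pairwise distinct slopes. *)
Lemma coset_forms_hadamard (R : realType) n (S : set 'rV[R]_(2 ^ n)) x :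
  maximal_distinct S ->
  forms_hadamard_matrix
    [set v | S v /\ exists p : cube n * bool, v = signs R (x + affine p)]%classic.
Proof.
move=> hS.
(* If [S] does not contain the vector of slope [a] and constant term [false],
   it contains its opposite, whose constant term is [true]. *)
pose row_of a : cube n * bool := (a, ~~ `[< S (signs R (x + affine (a, false))) >]).
have flip a b : signs R (x + affine (a, ~~ b)) = signs R (x + affine (a, b) + all_true _).
  rewrite -affine_true -addrA; congr (signs R (_ + _)).
  apply/ffunP => i; rewrite !ffunE /dot [\sum_j _ * _ in X in _ = _ + X]big1 => [|j _].
    by rewrite /= add0r -addrA; case: b.
  by rewrite ffunE mul0r.
have S_row a : S (signs R (x + affine (row_of a))).
  rewrite /row_of; case: asboolP => //= nS.
  by rewrite (flip a false); apply/maximal_signs.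
have row_uniq a b : S (signs R (x + affine (a, b))) -> (a, b) = row_of a.
  move=> Sab; congr (_, _); apply/eqP; apply: contraPT Sab => nb.
  (* The other constant term gives the opposite of a vector that is in [S]. *)
  move: nb (S_row a); rewrite /row_of; move: (~~ `[< _ >]) => c nb Sc.
  have -> : b = ~~ c by case: b c nb {Sc} => [] [].
  by rewrite flip maximal_signs // => /(_ Sc).
pose H : 'M[R]_(2 ^ n) := \matrix_i signs R (x + affine (row_of (point i))).
have hH : hadamard_matrix H.
  split=> [i|i j nij]; rewrite !rowK; first exact: signs_hadamard.
  apply: inner_translates => /=.
  by rewrite (inj_eq (bij_inj (point_bij n))).
rewrite (_ : mkset _ = [set row i H | i in [set: 'I_(2 ^ n)]]%classic).
  exact: forms_hadamard_rows.
apply/seteqP; split=> [v [Sv [[a b] ev]]|v [i _ <-]] /=; last first.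
  by rewrite rowK; split=> //; exists (row_of (point i)).
have [g _ gK] := point_bij n.
by exists (g a) => //; rewrite rowK gK ev -(row_uniq a b) // -ev.
Qed.

Lemma partition_pow2 (R : realType) n (S : set 'rV[R]_(2 ^ n)) :
  maximal_distinct S -> partitioned_into_hadamard (2 ^ (2 ^ n - n - 1)) S.
Proof.
move=> hS; rewrite -card_cosets.
have /and3P[/eqP cover_cosets triv_cosets _] := cosets_partition n.
exists (fun i : 'I_#|cosets n| =>
  [set v | S v /\ exists2 x, x \in (enum_val i : {set _}) & v = signs R x]%classic).
split.
- apply/seteqP; split=> [v Sv|v [i _ []] //].
  have [x ev] := hadamard_signs (hS.1 _ Sv).
  have : x \in finset.cover (cosets n) by rewrite cover_cosets inE.
  case/finset.bigcupP => C PC xC.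
  by exists (enum_rank_in PC C) => //=; split=> //; exists x; rewrite ?enum_rankK_in.
- move=> i j _ _ [v [[_ [x xi ->]] [_ [y yj /signs_inj exy]]]].
  apply: enum_val_inj.
  rewrite -(def_pblock triv_cosets (enum_valP i) xi) exy.
  exact: def_pblock triv_cosets (enum_valP j) yj.
- move=> i; have [x eC] := in_cosets (enum_valP i).
  rewrite (_ : mkset _ =
    [set v | S v /\ exists p : cube n * bool, v = signs R (x + affine p)]%classic).
    exact: coset_forms_hadamard.
  apply/seteqP; split=> v /= [Sv].
    by rewrite eC => -[y /imsetP[p _ ->] ev]; split=> //; exists p.
  by move=> [p ev]; split=> //; exists (x + affine p); rewrite // eC; apply/imsetP; exists p.
Qed.

(** * Counting *)

(** Negation exchanges the Hadamard vectors inside and outside of [S]. *)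
Lemma card_maximal (R : realType) m (S : set 'rV[R]_m) : maximal_distinct S ->
  (#|[pred x | `[< S (signs R x) >]]| * 2)%N = (2 ^ m)%N.
Proof.
move=> hS; set A := [pred x | _].
have -> : (2 ^ m)%N = #|{: {ffun 'I_m -> bool}}| by rewrite card_ffun card_bool card_ord.
rewrite -(cardC A) muln2 -addnn; congr addn.
have shift_bij := Bijective (addrK (all_true m)) (subrK (all_true m)).
rewrite -(on_card_preimset (onW_bij (mem A) shift_bij)); apply: eq_card => x.
rewrite !inE; apply/asboolP/asboolPn; first by move/(maximal_signs _ hS).
by move=> nSx; apply/(maximal_signs _ hS).
Qed.

(** Pairs (matrix, row number) inject into the Hadamard vectors: disjointness
    recovers the matrix, and the rows of a Hadamard matrix are distinct. *)
Lemma card_partitioned (R : realType) m k (S : set 'rV[R]_m) :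
  partitioned_into_hadamard k S -> #|[pred x | `[< S (signs R x) >]]| = (k * m)%N.
Proof.
move=> [B [-> tB hB]].
have /choice [H HP] i : exists H : 'M[R]_m, hadamard_matrix H /\
    B i = [set row j H | j in [set: 'I_m]]%classic.
  by have [_] := hB i.
have /choice [f fP] (p : 'I_k * 'I_m) : exists x, row p.2 (H p.1) = signs R x.
  by apply: hadamard_signs; apply: (HP p.1).1.1.
have Bf p : B p.1 (signs R (f p)) by rewrite (HP p.1).2 -fP; exists p.2.
have f_inj : injective f.
  move=> [i j] [i' j'] e.
  have ei : i = i'.
    apply: tB => //; exists (signs R (f (i, j))); split; first exact: Bf (i, j).
    by rewrite e; exact: Bf (i', j').
  subst i'; congr (_, _); apply: hadamard_row_inj (HP i).1 _ _ _ => /=.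
  by rewrite (fP (i, j)) e -(fP (i, j')).
have -> : (k * m)%N = #|{: 'I_k * 'I_m}| by rewrite card_prod !card_ord.
rewrite -(card_codom f_inj).
apply: eq_card => x; rewrite !inE; apply/asboolP/codomP => [[i _]|[p ->]].
  rewrite (HP i).2 => -[j _] e; exists (i, j); apply: (@signs_inj R).
  by rewrite -fP.
by exists p.1.
Qed.

End Hadamard.

Theorem theorem1p3 (R : realType) (m : nat) (hm : (1 <= m)%N) :
  (forall n : nat, m = (2 ^ n)%N ->
     forall S : set 'rV[R]_m, maximal_distinct S ->
       partitioned_into_hadamard (2 ^ (2 ^ n - n - 1))%N S) /\
  ((~ exists n : nat, m = (2 ^ n)%N) ->
     forall S : set 'rV[R]_m, maximal_distinct S ->
       ~ exists k : nat, partitioned_into_hadamard k S).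
Proof.
split=> [n em S|not_pow2 S hS [k /card_partitioned cardS]].
  by subst m; apply: partition_pow2.
apply: not_pow2.
have m_dvd : m %| 2 ^ m by rewrite -(card_maximal hS) cardS mulnAC dvdn_mull.
by have /(dvdn_pfactor _ _ (isT : prime 2)) [n _ ->] := m_dvd; exists n.
Qed.
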